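(* Let $\{\mathbf{X}_1,\dots,\mathbf{X}_n\}$ and $\{\mathbf{Y}_1,\dots,\mathbf{Y}_n\}$ be sets of two-dimensional random vectors. Suppose there exists $\lambda\in\Delta^n$ such that $\sum_{i=1}^n\lambda_i\mathbf{X}_i\succ_d\sum_{i=1}^n\lambda_i\mathbf{Y}_i$. Then for every $u\in\mathcal{U}$ with $\frac{\partial^2u(x_1,x_2)}{\partial x_1\partial x_2}\le 0$ there exists $i\in\{1,\dots,n\}$ with $\mathbb{E}\,u(\mathbf{X}_i)>\mathbb{E}\,u(\mathbf{Y}_i)$.
   Context: $\Delta^n=\{\lambda\in\mathbb{R}^n:\lambda_i\ge0,\ \sum_i\lambda_i=1\}$. For $\lambda\in\Delta^n$, $\sum_i\lambda_i\mathbf{X}_i$ denotes the mixture distribution (with probability law $\sum_i\lambda_i\,\mathrm{Law}(\mathbf{X}_i)$, so its CDF is $\sum_i\lambda_iF_{\mathbf{X}_i}$). For $\mathbf{x},\mathbf{y}\in\mathbb{R}^2$: $\mathbf{y}\preceq_p\mathbf{x}$ iff $y_i\le x_i$ for all $i$; $\mathbf{x}\succ_p\mathbf{y}$ iff $x_i\ge y_i$ for all $i$ and $x_i>y_i$ for some $i$. $\mathcal{U}$ is the class of strictly monotonically increasing $u:\mathbb{R}^2\to\mathbb{R}$ ($\mathbf{x}\succ_p\mathbf{y}\implies u(\mathbf{x})>u(\mathbf{y})$). CDF: $F_{\mathbf{X}}(\mathbf{x})=P(\mathbf{X}\preceq_p\mathbf{x})$. $\mathbf{X}\succeq_{\mathrm{FSD}}\mathbf{Y}$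 iff $F_{\mathbf{X}}\le F_{\mathbf{Y}}$ pointwise; $\mathbf{X}\succ_{\mathrm{FSD}}\mathbf{Y}$ iff additionally strict inequality at some point (same for real random variables). $\mathbf{X}\succ_d\mathbf{Y}$ iff $\mathbf{X}\succeq_{\mathrm{FSD}}\mathbf{Y}$ and $X_j\succ_{\mathrm{FSD}}Y_j$ for some marginal $j$. All expectations appearing are assumed to exist. *)

(* Defs.v *)
From HB Require Import structures.
From mathcomp Require Import all_boot all_order all_algebra.
From mathcomp Require Import all_classical all_reals all_analysis.
Set Implicit Arguments. Unset Strict Implicit. Unset Printing Implicit Defensive.
Import Order.TTheory GRing.Theory Num.Theory.
Local Open Scope classical_set_scope.
Local Open Scope ring_scope.

Section Defs.
Variable R : realType.

Definition simplex (n : nat) (lam : 'I_n -> R) : Prop :=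
  (forall i, 0 <= lam i) /\ \sum_(i < n) lam i = 1.

Definition law d (T : measurableType d) (P : probability T R) (X : T -> R * R)
  : set (R * R) -> \bar R := fun A => P (X @^-1` A).

(* law of the mixture sum_i lam_i X_i : sum_i lam_i Law(X_i) *)
Definition mixture (n : nat) (lam : 'I_n -> R) (mu : 'I_n -> set (R * R) -> \bar R)
  : set (R * R) -> \bar R := fun A => (\sum_(i < n) (lam i)%:E * mu i A)%E.

Definition lep (y x : R * R) : Prop := y.1 <= x.1 /\ y.2 <= x.2.
Definition gtp (x y : R * R) : Prop :=
  x.1 >= y.1 /\ x.2 >= y.2 /\ (x.1 > y.1 \/ x.2 > y.2).

Definition cdf2 (mu : set (R * R) -> \bar R) (x : R * R) : \bar R :=
  mu [set y | lep y x].
Definition cdf_m1 (mu : set (R * R) -> \bar R) (t : R) : \bar R :=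
  mu [set y | y.1 <= t].
Definition cdf_m2 (mu : set (R * R) -> \bar R) (t : R) : \bar R :=
  mu [set y | y.2 <= t].

(* first-order stochastic dominance expressed on CDFs *)
Definition fsd_weak (A : Type) (F G : A -> \bar R) : Prop := forall x, (F x <= G x)%E.
Definition fsd_strict (A : Type) (F G : A -> \bar R) : Prop :=
  fsd_weak F G /\ exists x, (F x < G x)%E.

Definition dom_d (mu nu : set (R * R) -> \bar R) : Prop :=
  fsd_weak (cdf2 mu) (cdf2 nu) /\
  (fsd_strict (cdf_m1 mu) (cdf_m1 nu) \/ fsd_strict (cdf_m2 mu) (cdf_m2 nu)).

Definition strictly_increasing (u : R * R -> R) : Prop :=
  forall x y, gtp x y -> u x > u y.

Definition d2 (u : R * R -> R) (x : R * R) : R := derive1 (fun t => u (x.1, t)) x.2.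
Definition d12 (u : R * R -> R) (x : R * R) : R := derive1 (fun s => d2 u (s, x.2)) x.1.

Definition mixed_partial_nonpos (u : R * R -> R) : Prop :=
  forall x : R * R,
    derivable (fun t => u (x.1, t)) x.2 1 /\
    derivable (fun s => d2 u (s, x.2)) x.1 1 /\
    d12 u x <= 0.

End Defs.

(* Main.v *)
Require Import Defs.
From HB Require Import structures.
From mathcomp Require Import all_boot all_order all_algebra.
From mathcomp Require Import all_classical all_reals all_analysis.
From mathcomp Require Import measurable_realfun ring lra.
Import Order.TTheory GRing.Theory Num.Theory.
Import numFieldNormedType.Exports.
Local Open Scope classical_set_scope.
Local Open Scope ring_scope.

(** Let [mu] and [nu] be the laws of the two mixtures.

    Weak inequality.  Truncating from above, [(M - u)^+] is nonnegative,
    decreasing and supermodular.  Rounding the second coordinate up to a grid,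
    such a function is approximated from below by nonnegative combinations of
    functions [f(x1) 1{x2 <= t}] with [f >= 0] nonincreasing; the layer-cake
    formula reduces their integrals to the measures of [A x ]-oo, t]] for lower
    sets [A], which the CDFs compare.  Truncating only from above costs no
    integrability, so [M -> oo] gives [E_nu u <= E_mu u].

    Strict inequality.  If the first marginals differ strictly at [s], there are
    [s < s'], [t] and [e > 0] with [F_mu + e <= F_nu] on [[s, s'[ x [t, +oo[].
    As [1_([s, s'[ x [t, +oo[)] is the CDF of the signed measure
    [delta_(s, t) - delta_(s', t)], the measures [mu + e delta_(s, t)] and
    [nu + e delta_(s', t)] are still ordered; the weak inequality applied to
    them (once normalised) gives
    [E_nu u + e u(s', t) <= E_mu u + e u(s, t)], and [u(s, t) < u(s', t)]. *)

(** * Layer-cake comparison and CDFs on lower sets *)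

(** By the layer-cake formula each integral is that of the tail function over [[0, +oo[], so it
    suffices to compare tails pointwise. *)
Lemma le_integral_superlevel (R : realType) (d : measure_display)
    (T : measurableType d) (mu nu : probability T R) (f : T -> R) :
  measurable_fun setT f -> (forall x, 0 <= f x) ->
  (forall r, 0 <= r -> (mu [set x | (r < f x)%R] <= nu [set x | (r < f x)%R])%E) ->
  (\int[mu]_x (f x)%:E <= \int[nu]_x (f x)%:E)%E.
Proof.
move=> mf f0 H.
pose F : {mfun T >-> R} := HB.pack f (isMeasurableFun.Build _ _ _ _ f mf).
have HE (m : probability T R) : (\int[m]_x (f x)%:E =
    \int[lebesgue_measure]_(r in `[0%R, +oo[) @ccdf d T R m F r)%E.
  have := @ge0_expectation_ccdf d T R m F f0.
  by rewrite expectation_def.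
rewrite !HE; apply: ge0_le_integral => //.
- exact: (measurable_funS measurableT (@subsetT _ _) (@ccdf_measurable _ _ _ mu F)).
- exact: (measurable_funS measurableT (@subsetT _ _) (@ccdf_measurable _ _ _ nu F)).
- move=> r /=; rewrite in_itv/= andbT => r0.
  have := H r r0; rewrite /ccdf /distribution /pushforward/=.
  suff -> : f @^-1` `]r, +oo[ = [set x | (r < f x)%R] by [].
  by apply/seteqP; split => x /=; rewrite in_itv/= andbT.
Qed.

(** Convertible with [fsd_weak] between the two [cdf2]: [mu], with the smaller CDF, is the
    dominating side. *)
Definition cdf_le {R : realType} (mu nu : set (R * R) -> \bar R) :=
  forall x, (mu [set y | lep y x] <= nu [set y | lep y x])%E.

Lemma lepE (R : realType) (x : R * R) :
  [set y | lep y x] = `]-oo, x.1]%classic `*` `]-oo, x.2]%classic.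
Proof. by apply/seteqP; split => -[a b] /=; rewrite /lep/= !in_itv/=. Qed.

Lemma measurable_lep (R : realType) (x : R * R) : measurable [set y : R * R | lep y x].
Proof. by rewrite lepE; exact: measurableX. Qed.

(** A nonempty lower set is the line, a closed half-line or an open one; the endpoints [n], [sup A]
    and [sup A - 1 / n.+1] respectively exhaust it by closed half-lines, on which CDFs give
    information. *)
Lemma lower_set_cases (R : realType) (A : set R) :
  (forall x y, y <= x -> A x -> A y) ->
  A = set0 \/ (exists2 s : nat -> R, {homo s : m n / (m <= n)%N >-> m <= n} &
    A = \bigcup_n `]-oo, s n]%classic).
Proof.
move=> lA; have [->|/set0P[a Aa]] := eqVneq A set0; [by left|right].
have [ubA|nubA] := pselect (has_ubound A); last first.
  exists (fun n => n%:R); first by move=> m n mn; rewrite ler_nat.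
  apply/seteqP; split => x /=.
    move=> _; exists (Num.truncn x).+1 => //=; rewrite in_itv/=.
    by rewrite ltW// truncnS_gt.
  move=> [n _ /=]; rewrite in_itv/= => xn.
  apply: contrapT => nAx; apply: nubA; exists x => y Ay.
  by rewrite leNgt; apply/negP => xy; apply: nAx; apply: lA Ay; exact: ltW.
have supA : has_sup A by split => //; exists a.
have [AsA|nAs] := pselect (A (sup A)).
  exists (fun=> sup A) => //.
  apply/seteqP; split => x /=.
    by move=> Ax; exists 0%N => //=; rewrite in_itv/=; exact: ub_le_sup.
  by move=> [n _ /=]; rewrite in_itv/= => xn; exact: lA AsA.
exists (fun n => sup A - n.+1%:R^-1).
  by move=> m n mn; rewrite lerD2l lerN2 lef_pV2 ?posrE// ler_nat.
apply/seteqP; split => x /=.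
  move=> Ax.
  have xs : 0 < sup A - x.
    rewrite subr_gt0 lt_neqAle ub_le_sup// andbT.
    by apply/eqP => xE; apply: nAs; rewrite -xE.
  exists (Num.truncn (sup A - x)^-1) => //=; rewrite in_itv/=.
  rewrite lerBrDr addrC -lerBrDr.
  rewrite -[leRHS]invrK lef_pV2 ?posrE ?invr_gt0//.
  by rewrite ltW// truncnS_gt.
move=> [n _ /=]; rewrite in_itv/= => xn.
have [|b Ab xb] := @sup_adherent _ A n.+1%:R^-1 _ supA; first by rewrite invr_gt0.
by apply: lA Ab; apply: (le_trans xn); exact: ltW.
Qed.

(** Continuity from below along quadrants increasing to the product. *)
Lemma cdf_le_lower_set (R : realType) (mu nu : probability (R * R)%type R)
    (A : set R) (t : R) : cdf_le mu nu ->
  (forall x y, y <= x -> A x -> A y) ->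
  (mu (A `*` `]-oo, t]%classic) <= nu (A `*` `]-oo, t]%classic))%E.
Proof.
move=> H lA; have [->|[s s_nd AE]] := lower_set_cases _ _ lA.
  by rewrite set0X !measure0.
pose F n := `]-oo, s n]%classic `*` `]-oo, t]%classic.
have mF n : measurable (F n) by exact: measurableX.
have AF : A `*` `]-oo, t]%classic = \bigcup_n F n.
  rewrite AE; apply/seteqP; split => -[x y] /=.
    by move=> [[n _ /= h] h2]; exists n => //; split.
  by move=> [n _ /= [h h2]]; split => //; exists n.
have ndF : nondecreasing_seq F.
  move=> m n mn; apply/subsetPset => -[x y] [h ht]; split => //.
  by move: h => /=; rewrite !in_itv/= => /le_trans; apply; exact: s_nd.
have cv (m : probability (R * R)%type R) : m \o F @ \oo --> m (\bigcup_n F n).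
  by apply: nondecreasing_cvg_mu => //; apply: bigcup_measurable => n _.
rewrite AF -(cvg_lim _ (cv mu))// -(cvg_lim _ (cv nu))//.
apply: lee_lim.
- by apply/cvg_ex; exists (mu (\bigcup_n F n)); exact: cv.
- by apply/cvg_ex; exists (nu (\bigcup_n F n)); exact: cv.
- by apply: nearW => n; have := H (s n, t); rewrite !lepE.
Qed.

(** * Discretisation of the second coordinate *)

Definition lstrip {R : realType} (f : R -> R) (t : R) (x : R * R) : R :=
  f x.1 * (x.2 <= t)%R%:R.

Lemma measurable_lstrip (R : realType) (f : R -> R) (t : R) :
  nonincreasing_fun f -> measurable_fun setT (lstrip f t).
Proof.
move=> nif; apply: measurable_funM.
  apply: measurableT_comp; last exact: measurable_fst.
  exact: nonincreasing_measurable.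
rewrite (_ : (fun x => _) = (\1_(`]-oo, t]%classic) : R -> R) \o snd).
  by apply: measurableT_comp; [exact: measurable_indic|exact: measurable_snd].
by apply/funext => x /=; rewrite indicE mem_setE in_itv.
Qed.

(** At a level [r >= 0] the superlevel set of a strip is a lower set times a half-line. *)
Lemma cdf_le_lstrip (R : realType) (mu nu : probability (R * R)%type R)
    (f : R -> R) (t : R) : cdf_le mu nu -> nonincreasing_fun f ->
  (forall x, 0 <= f x) ->
  (\int[mu]_x (lstrip f t x)%:E <= \int[nu]_x (lstrip f t x)%:E)%E.
Proof.
move=> H nif f0; apply: le_integral_superlevel.
- exact: measurable_lstrip.
- by move=> x; rewrite mulr_ge0.
- move=> r r0.
  rewrite (_ : [set x | _] = [set a | r < f a] `*` `]-oo, t]%classic).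
    apply: cdf_le_lower_set => // x y yx /= rfx.
    by rewrite (lt_le_trans rfx)// nif.
  apply/seteqP; split => -[x y] /=; rewrite in_itv/= /lstrip/=.
    case: (y <= t) => /=; rewrite ?mulr1 ?mulr0 //.
    by rewrite ltNge r0.
  by move=> [? ->]; rewrite mulr1.
Qed.

(** For a nondecreasing grid [t], this is [f] at the least [t j >= y] (and [0]
    beyond [t N]), written by Abel summation so that only half-lines [y <= t j]
    occur, with nonnegative coefficients when [f >= 0] is nonincreasing. *)
Definition step {R : realType} (f : R -> R) (t : nat -> R) (N : nat) (y : R) : R :=
  \sum_(j < N) (f (t j) - f (t j.+1)) * (y <= t j)%R%:R + f (t N) * (y <= t N)%R%:R.

Lemma stepS (R : realType) (f : R -> R) (t : nat -> R) (N : nat) (y : R) :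
  step f t N.+1 y =
  step f t N y + f (t N.+1) * ((y <= t N.+1)%R%:R - (y <= t N)%R%:R).
Proof. by rewrite /step big_ord_recr/=; ring. Qed.

Lemma step_ge0 (R : realType) (f : R -> R) (t : nat -> R) (N : nat) (y : R) :
  nonincreasing_fun f -> (forall x, 0 <= f x) ->
  {homo t : m n / (m <= n)%N >-> m <= n} -> 0 <= step f t N y.
Proof.
move=> nif f0 tnd; rewrite addr_ge0 ?mulr_ge0//.
by rewrite sumr_ge0// => i _; rewrite mulr_ge0// subr_ge0 nif// tnd.
Qed.

Lemma step_le (R : realType) (f : R -> R) (t : nat -> R) (N : nat) (y : R) :
  nonincreasing_fun f -> (forall x, 0 <= f x) ->
  {homo t : m n / (m <= n)%N >-> m <= n} -> step f t N y <= f y.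
Proof.
move=> nif f0 tnd.
(* The vanishing beyond [t N] is carried along for the induction: a point of the next cell starts
   from 0 and receives exactly [f (t N.+1)]. *)
suff [] : (t N < y -> step f t N y = 0) /\ step f t N y <= f y by [].
elim: N => [|N [IH0 IH]].
  rewrite /step big_ord0 add0r; split.
    by rewrite ltNge => /negbTE ->; rewrite mulr0.
  by case: (leP y (t 0%N)) => yt; rewrite ?mulr1 ?mulr0// nif.
rewrite stepS; have tN : t N <= t N.+1 by exact: tnd.
have [ytN|tNy] := leP y (t N).
  rewrite (le_trans ytN tN) subrr mulr0 addr0; split => //.
  by rewrite ltNge (le_trans ytN tN).
rewrite (IH0 tNy) add0r subr0.
have [ytN1|] := leP y (t N.+1); rewrite ?mulr1 ?mulr0//.
by split => //; exact: nif.
Qed.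

Lemma step_ge (R : realType) (f : R -> R) (t : nat -> R) (N i : nat) (y : R) :
  nonincreasing_fun f -> (forall x, 0 <= f x) ->
  {homo t : m n / (m <= n)%N >-> m <= n} -> (i <= N)%N -> y <= t i ->
  f (t i) <= step f t N y.
Proof.
move=> nif f0 tnd; elim: N => [|N IH].
  by rewrite leqn0 => /eqP -> yt; rewrite /step big_ord0 add0r yt mulr1.
rewrite leq_eqVlt => /predU1P[-> yt|]; last first.
  rewrite ltnS => iN yt; rewrite stepS !(le_trans yt) ?tnd//; last exact: leqW.
  by rewrite subrr mulr0 addr0 IH.
rewrite stepS yt mulrBr mulr1 addrCA lerDl subr_ge0.
(* It remains to bound [f (t N.+1) * (y <= t N)] by [step f t N y]: if [y <= t N] the last term
   [f (t N)] suffices, otherwise the bounded quantity is 0. *)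
rewrite /step; have [ytN|_] := leP y (t N); rewrite ?mulr0 ?mulr1; last first.
  rewrite addr0 sumr_ge0// => j _; rewrite mulr_ge0// subr_ge0 nif// tnd//.
rewrite (le_trans (nif _ _ (tnd _ _ (leqnSn N))))// lerDr.
by rewrite sumr_ge0// => j _; rewrite mulr_ge0// subr_ge0 nif// tnd.
Qed.

(** Mesh [1 / k.+1] from [- k.+1]; the index [2 * k.+1 * k.+1] is where [k.+1] is reached. *)
Definition grid {R : realType} (k j : nat) : R := j%:R / k.+1%:R - k.+1%:R.

Lemma grid_nd (R : realType) (k : nat) :
  {homo @grid R k : m n / (m <= n)%N >-> m <= n}.
Proof. by move=> m n mn; rewrite lerD2r ler_pM2r ?invr_gt0// ler_nat. Qed.

Definition gridstep {R : realType} (f : R -> R) (k : nat) (y : R) : R :=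
  step f (grid k) (2 * k.+1 * k.+1)%N y.

Lemma grid_next (R : realType) (k : nat) (y : R) : `|y| < k.+1%:R ->
  exists i, [/\ (i <= 2 * k.+1 * k.+1)%N, y <= grid k i & grid k i <= y + k.+1%:R^-1].
Proof.
rewrite ltr_norml => /andP[yl yr].
pose K : R := k.+1%:R; have K0 : 0 < K by rewrite ltr0n.
pose z := (y + K) * K.
have z0 : 0 <= z by rewrite mulr_ge0 ?ltW// -(opprK K) subr_gt0.
have /andP[tz zt] := truncn_itv z0.
(* [z] is the real-valued index of [y], so this is the first grid index strictly beyond [y]. *)
exists (Num.truncn z).+1; split.
- rewrite truncn_lt_nat// 2!natrM -/K ltr_pM2r//.
  by rewrite mulr_natl mulr2n ltrD2r.
- by rewrite /grid -/K lerBrDr ler_pdivlMr// ltW.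
- rewrite /grid -/K lerBlDr ler_pdivrMr// -natr1.
  by rewrite (_ : _ * K = z + 1) ?lerD2r// /z; field; rewrite gt_eqF.
Qed.

(** Once the grid covers [y], some grid point lies above [y] within one mesh, which squeezes the
    value between [f (y + harmonic k)] and [f y]. *)
Lemma gridstep_cvg (R : realType) (f : R -> R) (y : R) :
  nonincreasing_fun f -> (forall x, 0 <= f x) -> {for y, continuous f} ->
  gridstep f k y @[k --> \oo] --> f y.
Proof.
move=> nif f0 cf.
apply: (@squeeze_cvgr _ _ _ _ (fun k => f (y + harmonic k)) (fun=> f y)).
- near=> k; rewrite step_le ?andbT//; last exact: grid_nd.
  have [i [iN yi iy]] : exists i, [/\ (i <= 2 * k.+1 * k.+1)%N,
      y <= grid k i & grid k i <= y + k.+1%:R^-1].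
    apply: grid_next; rewrite (lt_le_trans (truncnS_gt _))// ler_nat ltnS.
    by near: k; exact: nbhs_infty_ge.
  rewrite (le_trans (nif _ _ iy))// step_ge//; exact: grid_nd.
- rewrite -{2}(addr0 y).
  apply: (@cvg_comp _ _ _ (fun k => y + harmonic k) f _ (nbhs (y + 0))).
    by apply: cvgD; [exact: cvg_cst|exact: cvg_harmonic].
  by rewrite addr0; exact: cf.
- exact: cvg_cst.
Unshelve. all: by end_near. Qed.

(** * Weak inequality of integrals *)

Lemma cdf_le_integral_supermodular (R : realType)
    (mu nu : probability (R * R)%type R) (g : R * R -> R) : cdf_le mu nu ->
  (forall x, 0 <= g x) ->
  (forall y, nonincreasing_fun (fun x => g (x, y))) ->
  (forall x, nonincreasing_fun (fun y => g (x, y))) ->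
  (forall a b c d, a <= b -> c <= d -> g (b, c) - g (b, d) <= g (a, c) - g (a, d)) ->
  (forall x, continuous (fun y => g (x, y))) ->
  mu.-integrable setT (EFin \o g) -> nu.-integrable setT (EFin \o g) ->
  (\int[mu]_x (g x)%:E <= \int[nu]_x (g x)%:E)%E.
Proof.
move=> H g0 g1 g2 gS gC img ing.
pose G k (x : R * R) : R := gridstep (fun y => g (x.1, y)) k x.2.
(* The Abel coefficients as functions of the first coordinate. Supermodularity makes the differences
   nonincreasing in [x]; the last coefficient is so by monotonicity of [g]. *)
pose F k j x := if (j < (2 * k.+1 * k.+1))%N then g (x, grid k j) - g (x, grid k j.+1)
   else g (x, grid k j).
have F1 k j : nonincreasing_fun (F k j).
  move=> a b ab; rewrite /F; case: ifPn => _; last exact: g1.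
  by apply: gS => //; exact: grid_nd.
have F0 k j x : 0 <= F k j x.
  by rewrite /F; case: ifPn => _ //; rewrite subr_ge0 g2// grid_nd.
have GE k : G k = fun x => \sum_(j < (2 * k.+1 * k.+1).+1) lstrip (F k j) (grid k j) x.
  apply/funext => x; rewrite big_ord_recr/= /G /gridstep /step; congr (_ + _).
    by apply: eq_bigr => i _; rewrite /lstrip /F ltn_ord.
  by rewrite /lstrip /F ltnn.
have mG k : measurable_fun setT (G k).
  by rewrite GE; apply: measurable_sum => j; exact: measurable_lstrip.
have G0 k x : 0 <= G k x by apply: step_ge0 => //; exact: grid_nd.
have Gg k x : G k x <= g x.
  by case: x => a b; apply: (@step_le _ (fun y => g (a, y))) => //; exact: grid_nd.
have GC x : G k x @[k --> \oo] --> g x.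
  by case: x => a b; apply: (@gridstep_cvg _ (fun y => g (a, y))) => //; exact: gC.
(* Since [0 <= G k <= g], the function [g] itself dominates the approximations. *)
have DC (m : probability (R * R)%type R) : m.-integrable setT (EFin \o g) ->
    (\int[m]_x (G k x)%:E)%E @[k --> \oo] --> (\int[m]_x (g x)%:E)%E.
  move=> ig.
  have [] := @dominated_convergence _ _ _ m setT measurableT
    (fun k x => (G k x)%:E) (EFin \o g) (EFin \o g) => //.
  - by move=> k; exact/measurable_EFinP.
  - exact: measurable_int ig.
  - apply: aeW => x _; apply: cvg_EFin; last exact: GC.
    by apply: nearW.
  - by apply: aeW => x k _ /=; rewrite lee_fin ger0_norm.
have GI k : (\int[mu]_x (G k x)%:E <= \int[nu]_x (G k x)%:E)%E.
  rewrite GE; under eq_integral do rewrite -sumEFin.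
  under [leRHS]eq_integral do rewrite -sumEFin.
  rewrite !ge0_integral_sum//; first last.
  - by move=> i x _; rewrite lee_fin mulr_ge0.
  - by move=> i; apply/measurable_EFinP; exact: measurable_lstrip.
  - by move=> i x _; rewrite lee_fin mulr_ge0.
  - by move=> i; apply/measurable_EFinP; exact: measurable_lstrip.
  by apply: lee_sum => i _; exact: cdf_le_lstrip.
rewrite -(cvg_lim _ (DC mu img))// -(cvg_lim _ (DC nu ing))//.
apply: lee_lim; last exact: nearW.
- by apply/cvg_ex; eexists; exact: DC.
- by apply/cvg_ex; eexists; exact: DC.
Qed.

(** The last clause is submodularity as decreasing differences. Unlike differentiability, it
    survives truncation of [u] from above, given the monotonicity. *)
Definition increasing_submodular {R : realType} (u : R * R -> R) : Prop :=
  [/\ forall y, nondecreasing_fun (fun x => u (x, y)),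
      forall x, nondecreasing_fun (fun y => u (x, y)) &
      forall a b c d, a <= b -> c <= d ->
        u (b, d) - u (b, c) <= u (a, d) - u (a, c)].

Lemma integral_probabilityD_cst (R : realType) (d : measure_display)
    (T : measurableType d) (m : probability T R) (f : T -> R) (r : R) :
  m.-integrable setT (EFin \o f) ->
  (\int[m]_x (f x + r)%:E = \int[m]_x (f x)%:E + r%:E)%E.
Proof.
move=> fi; under eq_integral do rewrite EFinD.
rewrite (integralD measurableT fi (finite_measure_integrable_cst _ r measurableT))//.
rewrite (integral_cst m measurableT r%:E); congr (_ + _)%E.
by rewrite -[RHS]mule1; congr (_ * _)%E; exact: probability_setT.
Qed.

Lemma cdf_le_integral_submodular (R : realType)
    (mu nu : probability (R * R)%type R) (u : R * R -> R) : cdf_le mu nu ->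
  increasing_submodular u -> (forall x, continuous (fun y => u (x, y))) ->
  mu.-integrable setT (EFin \o u) -> nu.-integrable setT (EFin \o u) ->
  (\int[nu]_x (u x)%:E <= \int[mu]_x (u x)%:E)%E.
Proof.
move=> H [u1 u2 uS] uC imu inu.
(* This is [- min(u, n)]; it is bounded by [|u|] in absolute value, and [h n + n] is the positive
   part of [n - u]. *)
pose h (n : nat) x := Order.max (- u x) (- n%:R).
have hC x : h n x @[n --> \oo] --> - u x.
  apply: cvg_near_cst; near=> n; apply/max_idPl.
  rewrite lerN2 (le_trans (ler_norm _))// ltW// (lt_le_trans (truncnS_gt _))//.
  by rewrite ler_nat; near: n; exact: nbhs_infty_ge.
have hu n x : `|h n x| <= `|u x|.
  rewrite /h; have n0 : 0 <= n%:R :> R by [].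
  move: (n%:R) n0 (u x) => N N0 v.
  by rewrite ler_norml; apply/andP; split; case: (leP (- v) (- N));
    case: (ger0P v) => *; lra.
have mh (m : probability (R * R)%type R) n : m.-integrable setT (EFin \o u) ->
    measurable_fun setT (h n).
  move=> /(measurable_int m)/measurable_EFinP mu'.
  by apply: measurable_maxr => //; exact: measurableT_comp.
have ih (m : probability (R * R)%type R) n : m.-integrable setT (EFin \o u) ->
    m.-integrable setT (EFin \o h n).
  move=> iu; apply: (le_integrable measurableT _ _ iu).
    by apply/measurable_EFinP; exact: (mh m).
  by move=> x _ /=; rewrite lee_fin.
have DC (m : probability (R * R)%type R) : m.-integrable setT (EFin \o u) ->
    (\int[m]_x (h n x)%:E)%E @[n --> \oo] --> (\int[m]_x (- u x)%:E)%E.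
  move=> iu.
  have [] := @dominated_convergence _ _ _ m setT measurableT
    (fun k x => (h k x)%:E) (fun x => (- u x)%:E) (abse \o (EFin \o u)) => //.
  - by move=> k; apply/measurable_EFinP; exact: (mh m).
  - apply/measurable_EFinP; apply: measurableT_comp => //.
    by apply/measurable_EFinP; exact: (measurable_int m).
  - apply: aeW => x _; apply: cvg_EFin; last exact: hC.
    by apply: nearW.
  - exact: integrable_abse.
  - by apply: aeW => x k _ /=; rewrite lee_fin.
have ic (m : probability (R * R)%type R) (n : nat) :
    m.-integrable setT (EFin \o cst (n%:R : R)).
  exact: finite_measure_integrable_cst.
have hI n : (\int[mu]_x (h n x)%:E <= \int[nu]_x (h n x)%:E)%E.
  have ig (m : probability (R * R)%type R) : m.-integrable setT (EFin \o u) ->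
      m.-integrable setT (EFin \o (fun x => h n x + n%:R)).
    by move=> iu; apply: (integrableD measurableT (ih m n iu) (ic m n)).
  (* The shift by [n] provides nonnegativity; it cancels because both measures have mass 1. *)
  have : (\int[mu]_x (h n x + n%:R)%:E <= \int[nu]_x (h n x + n%:R)%:E)%E.
    apply: cdf_le_integral_supermodular; rewrite ?ig// /h.
    - by move=> x; case: (leP (- u x) (- n%:R)) => *; lra.
    - move=> y a b ab; have /= := u1 y _ _ ab.
      by case: (leP (- u (a, y)) (- n%:R)); case: (leP (- u (b, y)) (- n%:R)) => *; lra.
    - move=> y a b ab; have /= := u2 y _ _ ab.
      by case: (leP (- u (y, a)) (- n%:R)); case: (leP (- u (y, b)) (- n%:R)) => *; lra.
    (* Monotonicity orders the values at the corners of the rectangle, so each pattern of truncated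
       corners is settled by linear arithmetic. *)
    - move=> a b c d ab cd; have := uS _ _ _ _ ab cd.
      have := u1 c _ _ ab; have := u1 d _ _ ab.
      have := u2 a _ _ cd; have := u2 b _ _ cd => /=.
      by case: (leP (- u (a, c)) (- n%:R)); case: (leP (- u (b, c)) (- n%:R));
        case: (leP (- u (a, d)) (- n%:R)); case: (leP (- u (b, d)) (- n%:R)) => *; lra.
    - move=> x y; apply: cvgD; last exact: cvg_cst.
      apply: (@continuous_max _ R^o (fun y => - u (x, y)) (fun=> - n%:R));
        last exact: cvg_cst.
      by apply: cvgN; exact: uC.
  by rewrite !integral_probabilityD_cst ?ih// leeD2rE.
have : (\int[mu]_x (- u x)%:E <= \int[nu]_x (- u x)%:E)%E.
  rewrite -(cvg_lim _ (DC mu imu))// -(cvg_lim _ (DC nu inu))//.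
  apply: lee_lim; last exact: nearW.
  - by apply/cvg_ex; eexists; exact: DC.
  - by apply/cvg_ex; eexists; exact: DC.
have E (m : probability (R * R)%type R) : m.-integrable setT (EFin \o u) ->
    (\int[m]_x (- u x)%:E = - \int[m]_x (u x)%:E)%E.
  move=> iu; under eq_integral do rewrite EFinN.
  rewrite integralN//; exact: integrable_add_def.
by rewrite !E// leeN2.
Unshelve. all: by end_near. Qed.

(** * Mixtures of probability measures *)

(** Linearity in the measure is clear for nonnegative functions and passes to integrable ones
    through positive and negative parts, whose integrals are finite. *)
Lemma mixture_probability (R : realType) (d : measure_display)
    (T : measurableType d) (n : nat) (lam : 'I_n -> R)
    (m : 'I_n -> probability T R) :
  (forall i, 0 <= lam i) -> \sum_(i < n) lam i = 1 ->
  exists Q : probability T R,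
    (forall A, Q A = \sum_(i < n) (lam i)%:E * m i A)%E /\
    (forall f : T -> R, (forall i, (m i).-integrable setT (EFin \o f)) ->
       Q.-integrable setT (EFin \o f) /\
       (\int[Q]_x (f x)%:E = \sum_(i < n) (lam i)%:E * \int[m i]_x (f x)%:E)%E).
Proof.
move=> lam0 lam1.
pose c i := NngNum (lam0 i).
(* [msum] expects a sequence over [nat]; indices from [n] on get the zero measure. *)
pose M k : {measure set T -> \bar R} :=
  if insub k is Some i then mscale (c i) (m i) else mzero.
have ME A : (msum M n A = \sum_(i < n) (lam i)%:E * m i A)%E.
  by rewrite /msum; apply: eq_bigr => i _; rewrite /M valK.
have M1 : msum M n setT = 1%E.
  rewrite ME; under eq_bigr do rewrite probability_setT mule1.
  by rewrite sumEFin lam1.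
pose Q : probability T R := HB.pack_for (probability T R) (msum M n)
  (Measure_isProbability.Build _ _ _ (msum M n) M1).
have QI (f : T -> \bar R) : measurable_fun setT f -> (forall x, 0 <= f x)%E ->
    (\int[Q]_x f x = \sum_(i < n) (lam i)%:E * \int[m i]_x f x)%E.
  move=> mf f0; rewrite /= ge0_integral_measure_sum//.
  by apply: eq_bigr => i _; rewrite /M valK ge0_integral_mscale.
exists Q; split => // f fi.
have [n0|n0] := posnP n.
  by exfalso; move: lam1; subst n; rewrite big_ord0 => /eqP; rewrite eq_sym oner_eq0.
have mf : measurable_fun setT (EFin \o f) by exact: (measurable_int _ (fi (Ordinal n0))).
split.
  apply/integrableP; split => //; rewrite QI//; last exact: measurableT_comp.
  apply: lte_sum_pinfty => i _; rewrite lte_mul_pinfty ?lee_fin//.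
  by have /integrableP[] := fi i.
have fN i : (\int[m i]_x (EFin \o f)^\- x \is a fin_num)%E.
  exact: (integrable_neg_fin_num measurableT (fi i)).
have fP i : (\int[m i]_x (EFin \o f)^\+ x \is a fin_num)%E.
  exact: (integrable_pos_fin_num measurableT (fi i)).
rewrite integralE !QI//; last 2 first.
- exact: measurable_funeneg.
- exact: measurable_funepos.
rewrite -sumeN; last first.
  by move=> i j _ _; rewrite fin_num_adde_defl// fin_numM.
rewrite -big_split/=; apply: eq_bigr => i _.
have -> : (\int[m i]_x (f x)%:E = \int[m i]_x (EFin \o f)^\+ x -
    \int[m i]_x (EFin \o f)^\- x)%E by rewrite integralE.
by rewrite [RHS]muleBr// fin_num_adde_defr.
Qed.

(** * Widening a marginal gap to a strip *)

(** Continuity from above lets [s] move right to [s'] on the [mu] side; continuity from below allows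
    a cut at a large [t] on the [nu] side. Each costs at most a third of the gap, and the last third
    is [e]. *)
Lemma cdf_gap (R : realType) (d : measure_display) (T : measurableType d)
    (mu nu : probability T R) (f g : T -> R) (s : R) :
  measurable_fun setT f -> measurable_fun setT g ->
  (mu [set x | (f x <= s)%R] < nu [set x | (f x <= s)%R])%E ->
  exists s' t e, [/\ s < s', 0 < e &
    (mu [set x | (f x <= s')%R] + e%:E <=
     nu ([set x | (f x <= s)%R] `&` [set x | (g x <= t)%R]))%E].
Proof.
move=> mf mg lt_s.
have ms (h : T -> R) r : measurable_fun setT h -> measurable [set x : T | (h x <= r)%R].
  move=> mh; have := mh measurableT `]-oo, r]%classic (measurable_itv _).
  by rewrite setTI [X in measurable X](_ : _ = [set x : T | (h x <= r)%R])//;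
    apply/seteqP; split => x /=; rewrite in_itv.
pose F n := [set x | (f x <= s + n.+1%:R^-1)%R].
pose G n := [set x | (f x <= s)%R] `&` [set x | (g x <= n%:R)%R].
have mF n : measurable (F n) by exact: ms.
have mG n : measurable (G n) by apply: measurableI; exact: ms.
have FE : \bigcap_n F n = [set x | (f x <= s)%R].
  apply/seteqP; split => x /=; last first.
    by move=> fs n _ /=; rewrite /F/= (le_trans fs)// lerDl invr_ge0.
  move=> h; rewrite leNgt; apply/negP => sf.
  have := h (Num.truncn (f x - s)^-1) I; apply/negP; rewrite /F/= -ltNge -ltrBrDl.
  rewrite -[ltRHS]invrK ltf_pV2 ?posrE ?invr_gt0 ?subr_gt0//.
  exact: truncnS_gt.
have GE : \bigcup_n G n = [set x | (f x <= s)%R].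
  apply/seteqP; split => x /=; first by move=> [n _ []].
  move=> fs; exists (Num.truncn (g x)).+1 => //.
  by split => //=; rewrite ltW// truncnS_gt.
have cF : mu \o F @ \oo --> mu [set x | (f x <= s)%R].
  rewrite -FE; apply: nonincreasing_cvg_mu => //.
  - by rewrite -ge0_fin_numE// fin_num_measure.
  - by rewrite FE; exact: ms.
  - move=> m n mn; apply/subsetPset => x /= /le_trans; apply.
    by rewrite lerD2l lef_pV2 ?posrE// ler_nat.
have cG : nu \o G @ \oo --> nu [set x | (f x <= s)%R].
  rewrite -GE; apply: nondecreasing_cvg_mu => //.
  - by rewrite GE; exact: ms.
  - move=> m n mn; apply/subsetPset => x [fs /= gm]; split => //=.
    by rewrite (le_trans gm)// ler_nat.
pose p := fine (mu [set x | (f x <= s)%R]).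
pose q := fine (nu [set x | (f x <= s)%R]).
have pE : mu [set x | (f x <= s)%R] = p%:E.
  by rewrite fineK// fin_num_measure//; exact: ms.
have qE : nu [set x | (f x <= s)%R] = q%:E.
  by rewrite fineK// fin_num_measure//; exact: ms.
rewrite pE in cF; rewrite qE in cG.
have pq : p < q by rewrite -lte_fin -pE -qE.
have [n /= nlt] : exists n, ((mu (F n) <= (p + (q - p) / 3)%:E) /\
    ((q - (q - p) / 3)%:E <= nu (G n)))%E.
  have nF : \forall n \near \oo, (mu (F n) < (p + (q - p) / 3)%:E)%E.
    have := cvgr_lt _ (fine_cvg cF) (p + (q - p) / 3); case; first by lra.
    by move=> N _ H; exists N => // n /H/=; rewrite -lte_fin fineK// fin_num_measure.
  have nG : \forall n \near \oo, ((q - (q - p) / 3)%:E < nu (G n))%E.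
    have := cvgr_gt _ (fine_cvg cG) (q - (q - p) / 3); case; first by lra.
    by move=> N _ H; exists N => // n /H/=; rewrite -lte_fin fineK// fin_num_measure.
  have [n _ H] : \forall n \near \oo, ((mu (F n) <= (p + (q - p) / 3)%:E) /\
    ((q - (q - p) / 3)%:E <= nu (G n)))%E.
    by near=> n; split; apply: ltW; near: n.
  by exists n; apply: H => /=.
exists (s + n.+1%:R^-1), n%:R, ((q - p) / 3); split.
- by rewrite ltrDl invr_gt0.
- by rewrite divr_gt0// subr_gt0.
- case: nlt => h1 h2; apply: le_trans h2; apply: (le_trans (leeD2r _ h1)).
  by rewrite -EFinD lee_fin; lra.
Unshelve. all: by end_near. Qed.

(** * Submodularity and measurability of [u] *)

Lemma derivable1_continuous_at (R : realType) (f : R -> R) (x : R) :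
  derivable f x 1 -> {for x, continuous f}.
Proof. by move=> /derivable1_diffP/differentiable_continuous. Qed.

Lemma derive1_le0_nonincreasing (R : realType) (f : R -> R) :
  (forall x, derivable f x 1) -> (forall x, derive1 f x <= 0) -> nonincreasing_fun f.
Proof.
move=> df f'0 x y xy; apply: (@ler0_derive1_le_cc _ f x y) => //.
- by apply: continuous_subspaceT => z; exact: derivable1_continuous_at.
- by rewrite in_itv/= xy lexx.
- by rewrite in_itv/= xy lexx.
Qed.

Lemma mixed_partial_continuous (R : realType) (u : R * R -> R) :
  mixed_partial_nonpos u -> forall x, continuous (fun y => u (x, y)).
Proof. by move=> Hu x y; apply: derivable1_continuous_at; have [] := Hu (x, y). Qed.

Lemma mixed_partial_submodular (R : realType) (u : R * R -> R) :
  strictly_increasing u -> mixed_partial_nonpos u -> increasing_submodular u.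
Proof.
move=> iu Hu.
have d2_ni y : nonincreasing_fun (fun s => d2 u (s, y)).
  by apply: derive1_le0_nonincreasing => s; have [_ []] := Hu (s, y).
have d1 x y : derivable (fun t => u (x, t)) y 1 by have [] := Hu (x, y).
split.
- move=> y a b; rewrite le_eqVlt => /predU1P[->//|ab].
  by apply/ltW/iu; split; [exact: ltW|split => //; left].
- move=> x a b; rewrite le_eqVlt => /predU1P[->//|ab].
  by apply/ltW/iu; split => //; split; [exact: ltW|right].
- move=> a b c d ab cd.
  (* The derivative of this difference is [d2 u (b, t) - d2 u (a, t)], nonpositive because [d2 u] is
     nonincreasing in the first coordinate. *)
  suff /(_ _ _ cd)/= : nonincreasing_fun (fun t => u (b, t) - u (a, t)) by lra.
  apply: derive1_le0_nonincreasing => t; first exact: derivableB.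
  rewrite derive1E deriveB// -!derive1E subr_le0.
  exact: (d2_ni t a b ab).
Qed.

(** A superlevel set is a countable union, over rational heights [q], of an upper set times [[q,
    +oo[]: continuity in the second coordinate lets a point descend to a rational height,
    monotonicity lets it climb back. *)
Lemma increasing_continuous_measurable (R : realType) (u : R * R -> R) :
  increasing_submodular u -> (forall x, continuous (fun y => u (x, y))) ->
  measurable_fun setT u.
Proof.
move=> [u1 u2 _] uC.
apply: (measurability (@RGenOInfty.G R)) => [|/= _ [_] [r] -> <-].
  exact: RGenOInfty.measurableE.
rewrite setTI.
have -> : u @^-1` `]r, +oo[ = \bigcup_(q in [set: rat])
    ([set a | r < u (a, ratr q)] `*` `[ratr q, +oo[%classic).
  apply/seteqP; split => -[a b] /=; rewrite in_itv/= andbT.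
    move=> rab.
    have [e /= e0 He] : nbhs b [set y | r < u (a, y)].
      exact: (cvgr_gt _ (uC a b)).
    have [q] := @rat_in_itvoo _ (b - e) b (ltac:(by rewrite ltrBlDr ltrDl)).
    rewrite in_itv/= => /andP[beq qb].
    exists q => //=; split => /=; last by rewrite in_itv/= andbT ltW.
    apply: He => /=; rewrite ger0_norm ?subr_ge0 1?ltW//.
    by rewrite ltrBlDr -ltrBlDl.
  move=> [q _ [/= rq]]; rewrite in_itv/= andbT => qb.
  by rewrite (lt_le_trans rq)// u2.
apply: bigcupT_measurable_rat => q; apply: measurableX => //.
apply: is_interval_measurable => x y /= rx _ z /andP[xz _].
by rewrite (lt_le_trans rx)// u1.
Qed.

(** * Strict inequality by perturbation *)

(** The normalisation of [m1 + e m2], as a mixture with weights [1 / (1 + e)] and [e / (1 + e)]. *)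
Lemma mixture2_probability (R : realType) (d : measure_display)
    (T : measurableType d) (m1 m2 : probability T R) (e : R) : 0 < e ->
  exists Q : probability T R,
    (forall A, measurable A -> Q A = (1 + e)^-1%:E * (m1 A + e%:E * m2 A))%E /\
    (forall f : T -> R, m1.-integrable setT (EFin \o f) ->
       m2.-integrable setT (EFin \o f) ->
       Q.-integrable setT (EFin \o f) /\
       (\int[Q]_x (f x)%:E = (1 + e)^-1%:E *
         (\int[m1]_x (f x)%:E + e%:E * \int[m2]_x (f x)%:E))%E).
Proof.
move=> e0; have e1 : 0 < 1 + e by rewrite addr_gt0.
pose lam (i : 'I_2) := if i == ord0 then (1 + e)^-1 else (1 + e)^-1 * e.
pose m (i : 'I_2) := if i == ord0 then m1 else m2.
have [||Q [QE QI]] := @mixture_probability R d T 2 lam m.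
- by move=> i; rewrite /lam; case: ifP => _; rewrite ?mulr_ge0 ?invr_ge0 ?ltW.
- by rewrite !big_ord_recl big_ord0 /lam/= addr0; field; rewrite gt_eqF.
exists Q; split.
  move=> A mA; rewrite QE !big_ord_recl big_ord0 /lam /m/= adde0.
  rewrite EFinM -muleA -muleDr// ge0_adde_def// inE ?measure_ge0//.
  by apply: mule_ge0; rewrite ?lee_fin ?measure_ge0// ltW.
move=> f f1 f2; have [|i1 ->] := QI f.
  by move=> i; rewrite /m; case: ifP.
split => //; rewrite !big_ord_recl big_ord0 /lam /m/= adde0.
rewrite EFinM -muleA -muleDr// fin_num_adde_defr//.
exact: integrable_fin_num.
Qed.

Lemma integral_dirac_EFin (R : realType) (d : measure_display)
    (T : measurableType d) (a : T) (f : T -> R) : measurable_fun setT f ->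
  (\d_a : probability T R).-integrable setT (EFin \o f) /\
  (\int[(\d_a : probability T R)]_x (f x)%:E = (f a)%:E)%E.
Proof.
move=> mf; have mf' : measurable_fun setT (EFin \o f) by exact/measurable_EFinP.
split; last by rewrite integral_dirac// diracT mul1e.
apply/integrableP; split => //.
rewrite integral_dirac//; last exact: measurableT_comp.
by rewrite diracT mul1e ltry.
Qed.

Lemma cdf_lt_integral_submodular (R : realType)
    (mu nu : probability (R * R)%type R) (u : R * R -> R) (p q : R * R) (e : R) :
  cdf_le mu nu -> gtp q p -> 0 < e ->
  (forall x, lep p x -> ~ lep q x ->
     (mu [set y | lep y x] + e%:E <= nu [set y | lep y x])%E) ->
  strictly_increasing u ->
  increasing_submodular u -> (forall x, continuous (fun y => u (x, y))) ->
  mu.-integrable setT (EFin \o u) -> nu.-integrable setT (EFin \o u) ->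
  (\int[nu]_x (u x)%:E < \int[mu]_x (u x)%:E)%E.
Proof.
move=> H qp e0 He iu su cu imu inu.
have mu_ : measurable_fun setT u by exact: increasing_continuous_measurable.
have [ip pE] := integral_dirac_EFin _ _ _ p _ mu_.
have [iq qE] := integral_dirac_EFin _ _ _ q _ mu_.
have e1 : 0 < (1 + e)^-1 by rewrite invr_gt0 addr_gt0.
have [M [ME MI]] := mixture2_probability _ _ _ mu (\d_p : probability _ _) _ e0.
have [N [NE NI]] := mixture2_probability _ _ _ nu (\d_q : probability _ _) _ e0.
have {MI}[iM MI] := MI _ imu ip.
have {NI}[iN NI] := NI _ inu iq.
have MN : cdf_le M N.
  (* Below [x] lie neither Dirac mass, both, or only the one at [p]; in the last case the gap [He]
     absorbs [e]. *)
  move=> x; rewrite ME ?NE; [|exact: measurable_lep..].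
  rewrite lee_pmul2l//= !diracE.
  have [lpx|nlpx] := pselect (lep p x); last first.
    have nlqx : ~ lep q x.
      move=> [q1 q2]; apply: nlpx; case: qp => p1 [p2 _].
      by split; [apply: le_trans q1|apply: le_trans q2].
    by rewrite !memNset//= !mule0 !adde0.
  have [lqx|nlqx] := pselect (lep q x).
    by rewrite !mem_set//= !mule1 leeD2r.
  by rewrite mem_set// memNset//= mule1 mule0 adde0 He.
have := cdf_le_integral_submodular _ _ _ _ MN su cu iM iN.
rewrite MI NI lee_pmul2l// pE qE.
have := iu _ _ qp.
have fmu : (\int[mu]_x (u x)%:E \is a fin_num)%E by exact: integrable_fin_num.
have fnu : (\int[nu]_x (u x)%:E \is a fin_num)%E by exact: integrable_fin_num.
rewrite -(fineK fmu) -(fineK fnu) -!EFinM -!EFinD lee_fin lte_fin => upq h.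
have : e * u p < e * u q by rewrite ltr_pM2l.
lra.
Qed.

(** * From measures on the plane to random vectors *)

Theorem theorem5p1 (R : realType) (d : measure_display) (T : measurableType d)
  (P : probability T R) (n : nat) (X Y : 'I_n -> T -> R * R) :
  (forall i, measurable_fun setT (X i)) ->
  (forall i, measurable_fun setT (Y i)) ->
  (exists lam : 'I_n -> R, simplex lam /\
     dom_d (mixture lam (fun i => law P (X i))) (mixture lam (fun i => law P (Y i)))) ->
  forall u : R * R -> R,
    strictly_increasing u ->
    mixed_partial_nonpos u ->
    (forall i, P.-integrable setT (fun w => (u (X i w))%:E)) ->
    (forall i, P.-integrable setT (fun w => (u (Y i w))%:E)) ->
    exists i : 'I_n,
      (\int[P]_w (u (Y i w))%:E < \int[P]_w (u (X i w))%:E)%E.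
Proof.
move=> mX mY [lam [[lam0 lam1] [dle dlt]]] u iu du iX iY.
have su := mixed_partial_submodular _ _ iu du.
have cu := mixed_partial_continuous _ _ du.
have mu_ : measurable_fun setT u by exact: increasing_continuous_measurable.
(* The mixture of the laws is a probability measure on the plane, and change of variables turns its
   integral of [u] into the weighted sum of expectations. *)
have mixE (Z : 'I_n -> T -> R * R) (mZ : forall i, measurable_fun setT (Z i)) :
    (forall i, P.-integrable setT (fun w => (u (Z i w))%:E)) ->
    exists Q : probability (R * R)%type R,
    [/\ mixture lam (fun i => law P (Z i)) = Q, Q.-integrable setT (EFin \o u) &
     (\int[Q]_x (u x)%:E = \sum_(i < n) (lam i)%:E * \int[P]_w (u (Z i w))%:E)%E].
  move=> iZ.
  pose Z' i : {mfun T >-> (R * R)%type} :=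
    HB.pack (Z i) (isMeasurableFun.Build _ _ _ _ (Z i) (mZ i)).
  have [Q [QE QI]] := mixture_probability _ _ _ _ lam
    (fun i => distribution P (Z' i)) lam0 lam1.
  have [|iQ IQ] := QI u.
    move=> i; apply: (@integrable_pushforward _ _ _ _ R (Z' i) _ P setT
      (EFin \o u)) => //.
      exact/measurable_EFinP.
    exact: iZ.
  exists Q; split => //; first by apply/funext => A; rewrite QE.
  rewrite IQ; apply: eq_bigr => i _; congr (_ * _)%E.
  rewrite (@integral_pushforward _ _ _ _ R (Z' i) _ P setT (EFin \o u))//.
    exact/measurable_EFinP.
  exact: iZ.
have [QX [QXE iQX IX]] := mixE X mX iX.
have [QY [QYE iQY IY]] := mixE Y mY iY.
rewrite QXE QYE in dle dlt.
have lt_int : (\int[QY]_x (u x)%:E < \int[QX]_x (u x)%:E)%E.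
  have mlep := @measurable_lep R.
  have ms (h : R * R -> R) r : measurable_fun setT h -> measurable [set x | (h x <= r)%R].
    move=> mh; have := mh measurableT `]-oo, r]%classic (measurable_itv _).
    by rewrite setTI [X in measurable X](_ : _ = [set x | (h x <= r)%R])//;
      apply/seteqP; split => x /=; rewrite in_itv.
  case: dlt => -[_ [s /= lts]].
    have [s' [t [e [ss' e0 gap]]]] := cdf_gap _ _ _ _ _ fst snd s
      measurable_fst measurable_snd lts.
    apply: (@cdf_lt_integral_submodular R QX QY u (s, t) (s', t) e) => //.
      by split => /=; [exact: ltW|split => //; left].
    move=> [x1 x2] [/= s1 t2] nlep.
    have x1s' : x1 <= s' by rewrite leNgt; apply/negP => /ltW sx; apply: nlep.
    (* The quadrant below [(x1, x2)] lies in the half-plane up to [s'] and contains the quadrant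
       below [(s, t)]. *)
    apply: le_trans (le_trans gap _).
      rewrite leeD2r// le_measure ?inE//; first exact: ms.
      by move=> y [/= y1 _]; exact: le_trans y1 _.
    rewrite le_measure ?inE//; first by apply: measurableI; exact: ms.
    by move=> y [/= y1 y2]; split; [exact: le_trans y1 _|exact: le_trans y2 _].
  (* The same argument with the coordinates exchanged. *)
  have [s' [t [e [ss' e0 gap]]]] := cdf_gap _ _ _ _ _ snd fst s
    measurable_snd measurable_fst lts.
  apply: (@cdf_lt_integral_submodular R QX QY u (t, s) (t, s') e) => //.
    by split => //=; split; [exact: ltW|right].
  move=> [x1 x2] [/= t1 s2] nlep.
  have x2s' : x2 <= s' by rewrite leNgt; apply/negP => /ltW sx; apply: nlep.
  apply: le_trans (le_trans gap _).
    rewrite leeD2r// le_measure ?inE//; first exact: ms.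
    by move=> y [/= _ y2]; exact: le_trans y2 _.
  rewrite le_measure ?inE//; first by apply: measurableI; exact: ms.
  by move=> y [/= y2 y1]; split; [exact: le_trans y1 _|exact: le_trans y2 _].
(* If no index were strict, summing the reversed inequalities with nonnegative weights would
   contradict [lt_int]. *)
apply: contrapT => nex; move: lt_int; apply/negP; rewrite -leNgt IX IY.
apply: lee_sum => i _; apply: lee_wpmul2l; first by rewrite lee_fin.
by rewrite leNgt; apply/negP => lti; apply: nex; exists i.
Qed.
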